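(* The semigroup algebra $\mathbb{C}S$ has the property of direct finiteness: for $a,b\in\mathbb{C}S$, $ba=1$ if and only if $ab=1$.
   Context: $S$ is the semigroup with identity generated by $x$ and $y$, subject to $y$ being invertible and $yx=xy^2$; thus $S=\{x^my^n:m\in\mathbb{Z},\ m\ge0,\ n\in\mathbb{Z}\}$ with product $x^my^n\,x^py^q=x^{m+p}y^{n2^p+q}$. $\mathbb{C}S$ is its complex semigroup algebra. *)

(* Defs.v *)
From HB Require Import structures.
From mathcomp Require Import all_boot all_order all_algebra.
From mathcomp Require Import finmap.
From mathcomp.multinomials Require Import monalg.
From mathcomp Require Import reals.
From mathcomp Require Import complex.

Set Implicit Arguments.
Unset Strict Implicit.
Unset Printing Implicit Defensive.

Import Order.TTheory GRing.Theory Num.Theory.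
Local Open Scope ring_scope.

(* The ring structure that [monalg] puts on [{malg R[M]}] requires            *)
(* [x * y = 1 -> x = 1 /\ y = 1] in M, which fails as soon as M has a         *)
(* nontrivial invertible element. Only the underlying module of finitely      *)
(* supported functions M -> R is reused below, under a fresh name, with the   *)
(* convolution product of an arbitrary monoid.                                *)
Definition monoid_algebra (R : nzRingType) (M : monoidType) : Type :=
  {malg R[M]}.

HB.instance Definition _ (R : nzRingType) (M : monoidType) :=
  GRing.Lmodule.on (monoid_algebra R M).

Section MonoidAlgebra.
Context (R : nzRingType) (M : monoidType).
Implicit Types (g : {malg R[M]}) (k : M).

Definition ma_one : {malg R[M]} := mkmalgU (1%g : M) 1.

Definition ma_mul g1 g2 : {malg R[M]} :=
  \sum_(k1 <- msupp g1) \sum_(k2 <- msupp g2)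
     mkmalgU (k1 * k2)%g (mcoeff k1 g1 * mcoeff k2 g2).

Lemma ma_mulw (d1 d2 : {fset M}) g1 g2 :
  (msupp g1 `<=` d1)%fset -> (msupp g2 `<=` d2)%fset ->
  ma_mul g1 g2 = \sum_(k1 <- d1) \sum_(k2 <- d2)
     mkmalgU (k1 * k2)%g (mcoeff k1 g1 * mcoeff k2 g2).
Proof.
move=> le_d1 le_d2; rewrite /ma_mul (big_fset_incl _ le_d1) /=.
  apply/eq_bigr=> k1 _; apply/big_fset_incl => // k _ /mcoeff_outdom ->.
  by rewrite mulr0 monalgU0.
move=> k _ /mcoeff_outdom g1k.
by rewrite big1 => // k' _; rewrite g1k mul0r monalgU0.
Qed.

Lemma ma_mul0g : left_zero 0 ma_mul.
Proof. by move=> g; rewrite /ma_mul msupp0 big_seq_fset0. Qed.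

Lemma ma_mulg0 : right_zero 0 ma_mul.
Proof.
move=> g; by rewrite /ma_mul exchange_big /= msupp0 big_seq_fset0.
Qed.

Lemma ma_mulUg c k g :
  ma_mul (mkmalgU k c) g =
  \sum_(k' <- msupp g) mkmalgU (k * k')%g (c * mcoeff k' g).
Proof.
rewrite (ma_mulw msuppU_le (fsubset_refl _)) big_seq_fset1.
by apply/eq_bigr => k' _; rewrite mcoeffUU.
Qed.

Lemma ma_mulgU c k g :
  ma_mul g (mkmalgU k c) =
  \sum_(k' <- msupp g) mkmalgU (k' * k)%g (mcoeff k' g * c).
Proof.
rewrite (ma_mulw (fsubset_refl _) msuppU_le); apply/eq_bigr=> k' _.
by rewrite big_seq_fset1 mcoeffUU.
Qed.

Lemma ma_mulUU c1 c2 k1 k2 :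
  ma_mul (mkmalgU k1 c1) (mkmalgU k2 c2) = mkmalgU (k1 * k2)%g (c1 * c2).
Proof.
by rewrite (ma_mulw msuppU_le msuppU_le) !big_seq_fset1 !mcoeffUU.
Qed.

Lemma ma_mulEl g1 g2 :
  ma_mul g1 g2 = \sum_(k1 <- msupp g1) ma_mul (mkmalgU k1 (mcoeff k1 g1)) g2.
Proof. by apply/eq_bigr=> k _; rewrite ma_mulUg. Qed.

Lemma ma_mulEr g1 g2 :
  ma_mul g1 g2 = \sum_(k2 <- msupp g2) ma_mul g1 (mkmalgU k2 (mcoeff k2 g2)).
Proof.
by rewrite {1}/ma_mul exchange_big; apply/eq_bigr=> k _; rewrite ma_mulgU.
Qed.

Lemma ma_mul1g : left_id ma_one ma_mul.
Proof.
move=> g; rewrite ma_mulUg [RHS]monalgE.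
by apply/eq_bigr=> k _; rewrite mul1r mul1g.
Qed.

Lemma ma_mulg1 : right_id ma_one ma_mul.
Proof.
move=> g; rewrite ma_mulgU [RHS]monalgE.
by apply/eq_bigr=> k _; rewrite mulr1 mulg1.
Qed.

Lemma ma_mulDl : left_distributive ma_mul +%R.
Proof.
move=> g1 g2 g.
rewrite (ma_mulw (msuppD_le _ _) (fsubset_refl _)).
rewrite (ma_mulw (fsubsetUl _ (msupp g2)) (fsubset_refl _)).
rewrite (ma_mulw (fsubsetUr (msupp g1) _) (fsubset_refl _)).
rewrite -big_split /=; apply/eq_bigr=> k1 _.
rewrite -big_split /=; apply/eq_bigr=> k2 _.
by rewrite mcoeffD mulrDl monalgUD.
Qed.

Lemma ma_mulDr : right_distributive ma_mul +%R.
Proof.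
move=> g g1 g2.
rewrite (ma_mulw (fsubset_refl _) (msuppD_le _ _)).
rewrite (ma_mulw (fsubset_refl _) (fsubsetUl _ (msupp g2))).
rewrite (ma_mulw (fsubset_refl _) (fsubsetUr (msupp g1) _)).
rewrite -big_split /=; apply/eq_bigr=> k1 _.
rewrite -big_split /=; apply/eq_bigr=> k2 _.
by rewrite mcoeffD mulrDr monalgUD.
Qed.

Lemma ma_mulA : associative ma_mul.
Proof.
move=> g1 g2 g3.
rewrite [RHS](big_morph (ma_mul^~ _) (fun _ _ => ma_mulDl _ _ _) (ma_mul0g _)).
rewrite ma_mulEl; apply/eq_bigr=> k1 _.
rewrite [LHS](big_morph (ma_mul _) (fun _ _ => ma_mulDr _ _ _) (ma_mulg0 _)).
rewrite [RHS](big_morph (ma_mul^~ _) (fun _ _ => ma_mulDl _ _ _) (ma_mul0g _)).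
apply/eq_bigr=> k2 _.
rewrite [LHS](big_morph (ma_mul _) (fun _ _ => ma_mulDr _ _ _) (ma_mulg0 _)).
by rewrite ma_mulEr; apply/eq_bigr=> k3 _; rewrite !ma_mulUU mulrA mulgA.
Qed.

Lemma ma_one_neq0 : ma_one != 0.
Proof.
apply/eqP=> /malgP /(_ 1%g) /eqP.
by rewrite mcoeffUU mcoeff0 oner_eq0.
Qed.

HB.instance Definition _ := GRing.Zmodule_isNzRing.Build (monoid_algebra R M)
  ma_mulA ma_mul1g ma_mulg1 ma_mulDl ma_mulDr ma_one_neq0.

Lemma ma_scaleAl (c : R) (g1 g2 : monoid_algebra R M) :
  c *: (g1 * g2) = (c *: g1) * g2.
Proof.
have E (g : monoid_algebra R M) :
    c *: g = (mkmalgU (1%g : M) c : monoid_algebra R M) * g.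
  rewrite -[RHS]/(ma_mul _ _) ma_mulUg -[LHS]/(fgscale c g) /fgscale.
  by apply/eq_bigr=> k _; rewrite mul1g.
by rewrite !E mulrA.
Qed.

HB.instance Definition _ :=
  GRing.Lmodule_isLalgebra.Build R (monoid_algebra R M) ma_scaleAl.

End MonoidAlgebra.

Lemma ma_scaleAr (R : comNzRingType) (M : monoidType) (c : R)
  (g1 g2 : monoid_algebra R M) : c *: (g1 * g2) = g1 * (c *: g2).
Proof.
have le : (msupp (c *: g2 : {malg R[M]}) `<=` msupp g2)%fset.
  exact: msuppZ_le.
rewrite -[LHS]/(c *: ma_mul g1 g2) -[RHS]/(ma_mul g1 (c *: (g2 : {malg R[M]}))).
rewrite (ma_mulw (fsubset_refl _) le) /ma_mul.
apply/malgP => k; rewrite mcoeffZ !raddf_sum mulr_sumr /=.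
apply/eq_bigr=> k1 _; rewrite !raddf_sum mulr_sumr /=.
by apply/eq_bigr=> k2 _; rewrite !mcoeffU mcoeffZ mulrnAr mulrCA.
Qed.

HB.instance Definition _ (R : comNzRingType) (M : monoidType) :=
  GRing.Lalgebra_isAlgebra.Build R (monoid_algebra R M) (@ma_scaleAr R M).

(* [SXY m n] stands for the normal form x^m y^n; the product rule comes from  *)
(* y^n x^p = x^p y^(n 2^p).                                                   *)
Record Sxy : Type := SXY { xexp : nat; yexp : int }.

Definition Sxy_pair (s : Sxy) : nat * int := (xexp s, yexp s).
Definition pair_Sxy (p : nat * int) : Sxy := SXY p.1 p.2.
Lemma Sxy_pairK : cancel Sxy_pair pair_Sxy. Proof. by case. Qed.

HB.instance Definition _ := Countable.copy Sxy (can_type Sxy_pairK).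

Definition Sxy_one : Sxy := SXY 0 0.
Definition Sxy_mul (s t : Sxy) : Sxy :=
  SXY (xexp s + xexp t) (yexp s * 2 ^+ xexp t + yexp t).

Lemma Sxy_mulA : associative Sxy_mul.
Proof.
move=> [m n] [p q] [r s]; congr SXY => /=; first by rewrite addnA.
by rewrite exprD mulrDl !mulrA !addrA.
Qed.

Lemma Sxy_mul1 : left_id Sxy_one Sxy_mul.
Proof. by move=> [m n]; congr SXY; rewrite /= mul0r add0r. Qed.

Lemma Sxy_mulone : right_id Sxy_one Sxy_mul.
Proof.
by move=> [m n]; congr SXY; rewrite /= ?addn0 // expr0 mulr1 addr0.
Qed.

HB.instance Definition _ := isMonoid.Build Sxy Sxy_mulA Sxy_mul1 Sxy_mulone.

Definition Sx : Sxy := SXY 1 0.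
Definition Sy : Sxy := SXY 0 1.
Definition SyV : Sxy := SXY 0 (-1).

(* Sxy is the monoid presented by generators x, y, y^-1 and the relations     *)
(* y y^-1 = y^-1 y = 1, y x = x y^2: the relations hold, and any solution     *)
(* (u, v, v^-1) of them in a monoid M comes from exactly one morphism.        *)

Section Presentation.
Local Open Scope group_scope.

Lemma SyK : Sy * SyV = 1. Proof. by []. Qed.
Lemma SyVK : SyV * Sy = 1. Proof. by []. Qed.
Lemma SyxE : Sy * Sx = Sx * Sy ^+ 2. Proof. by []. Qed.

Lemma SxXE m : Sx ^+ m = SXY m 0.
Proof.
elim: m => [|m IH] //; rewrite expgS IH; congr SXY.
by rewrite /= mul0r.
Qed.

Lemma SyXE n : Sy ^+ n = SXY 0 n%:Z.
Proof. by elim: n => [|n IH] //; rewrite expgS IH; congr SXY. Qed.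

Lemma SyVXE n : SyV ^+ n = SXY 0 (- n%:Z)%R.
Proof.
elim: n => [|n IH] //; rewrite expgS IH; congr SXY.
by rewrite /= expr0 mulr1 intS opprD.
Qed.

Definition zpow (M : monoidType) (v w : M) (n : int) : M :=
  match n with Posz k => v ^+ k | Negz k => w ^+ k.+1 end.

Lemma SxyE m n : SXY m n = Sx ^+ m * zpow Sy SyV n.
Proof.
rewrite SxXE; case: n => n /=; first rewrite SyXE; last rewrite SyVXE -NegzE.
  by congr SXY; rewrite /= ?addn0 // mul0r add0r.
by congr SXY; rewrite /= ?addn0 // mul0r add0r.
Qed.

Lemma monoid_morphismX (M N : monoidType) (f : M -> N) :
  monoid.monoid_morphism f -> forall x n, f (x ^+ n) = f x ^+ n.
Proof.
by move=> [f1 fM] x; elim=> [|n IH]; rewrite ?expg0 // !expgS fM IH.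
Qed.

Section Universal.
Variables (M : monoidType) (u v w : M).
Hypotheses (vw : v * w = 1) (wv : w * v = 1) (vu : v * u = u * v ^+ 2).

Let wu : w * u = u * w ^+ 2.
Proof.
have vvww : v ^+ 2 * w ^+ 2 = 1.
  by rewrite !expg2 -mulgA (mulgA v w w) vw mul1g vw.
by rewrite -[LHS]mulg1 -vvww mulgA -(mulgA w) -vu (mulgA w) wv mul1g.
Qed.

Let zpowS n : zpow v w (n + 1)%R = zpow v w n * v.
Proof.
case: n => [n|[|n]]; first by rewrite -PoszD addn1 /= expgSr.
  by rewrite /= expg1 wv.
have -> : (Negz n.+1 + 1 = Negz n)%R.
  by rewrite !NegzE [in LHS]intS opprD addrAC addNr add0r.
by rewrite /= [in RHS]expgSr -mulgA wv mulg1.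
Qed.

Let zpowP n : zpow v w (n - 1)%R = zpow v w n * w.
Proof. by rewrite -{2}[n](subrK 1%R) zpowS -mulgA vw mulg1. Qed.

Let zpowD n p : zpow v w (n + p)%R = zpow v w n * zpow v w p.
Proof.
elim: p => [|p IH|p IH]; first by rewrite addr0 /= mulg1.
  by rewrite intS [(1 + _)%R]addrC addrA !zpowS IH mulgA.
by rewrite intS opprD [(-1 + _)%R]addrC addrA !zpowP IH mulgA.
Qed.

Let zpow_u n : zpow v w n * u = u * zpow v w (n * 2)%R.
Proof.
elim: n => [|n IH|n IH]; first by rewrite mul0r /= mul1g mulg1.
  rewrite intS [(1 + _)%R]addrC zpowS mulrDl mul1r zpowD -mulgA vu mulgA IH.
  by rewrite -mulgA.
rewrite intS opprD [(-1 + _)%R]addrC zpowP mulrDl mulN1r zpowD -mulgA wu.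
by rewrite mulgA IH -mulgA.
Qed.

Let zpow_uX n p : zpow v w n * u ^+ p = u ^+ p * zpow v w (n * 2 ^+ p)%R.
Proof.
elim: p n => [|p IH] n; first by rewrite expr0 mulr1 !expg0 mul1g mulg1.
by rewrite expgS mulgA zpow_u -mulgA IH mulgA exprS mulrA.
Qed.

Lemma Sxy_universal :
  exists f : Sxy -> M,
    [/\ monoid.monoid_morphism f, f Sx = u, f Sy = v &
      forall g : Sxy -> M, monoid.monoid_morphism g ->
        g Sx = u -> g Sy = v -> g =1 f].
Proof.
exists (fun s => u ^+ xexp s * zpow v w (yexp s)); split.
- split=> [|[m n] [p q]]; first by rewrite /= mulg1.
  rewrite -[LHS]/(u ^+ (m + p) * zpow v w (n * 2 ^+ p + q)%R) /= expgnDr zpowD.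
  by rewrite -!mulgA; congr (_ * _); rewrite !mulgA zpow_uX.
- by rewrite /= expg1 mulg1.
- by rewrite /= expg0 mul1g expg1.
move=> g gmor gx gy [m n] /=; have [g1 gM] := gmor.
have gV : g SyV = w.
  by rewrite -[LHS]mul1g -wv -mulgA -{1}gy -gM SyK g1 mulg1.
rewrite SxyE gM (monoid_morphismX gmor) gx; congr (_ * _).
by case: n => n /=; rewrite (monoid_morphismX gmor) ?gy ?gV.
Qed.
End Universal.
End Presentation.

(* A realType is a complete archimedean ordered field, i.e. the real numbers  *)
(* up to isomorphism, so that R[i] is the field of complex numbers.           *)
Definition CS (R : realType) : Type := monoid_algebra R[i] Sxy.

HB.instance Definition _ (R : realType) :=
  GRing.Algebra.copy (CS R) (monoid_algebra R[i] Sxy).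

(* Main.v *)
Require Import Defs.
From mathcomp Require Import all_boot all_order all_algebra.
From mathcomp Require Import finmap complex.
From mathcomp.multinomials Require Import monalg.
From mathcomp Require Import reals.

(** Ordering the normal forms x^m y^n lexicographically by (m, n) makes S an
    ordered monoid: the product rule (m, n) (p, q) = (m + p, n 2^p + q) is
    strictly increasing in each factor, because 2^p > 0. The product of the
    largest elements of two finite sets is therefore attained only once
    ([Sxy_unique_products]), so that the leading terms of two nonzero elements
    of the algebra cannot cancel, and the algebra has no zero divisors
    ([ma_mul_eq0]). In a ring without zero divisors, b a = 1 gives
    b (a b - 1) = 0 with b nonzero, whence a b = 1. *)

Set Implicit Arguments.
Unset Strict Implicit.
Unset Printing Implicit Defensive.

Import Order.TTheory GRing.Theory Num.Theory.
Local Open Scope ring_scope.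

(** Unique product property: for any two nonempty finite subsets A and B of M,
    some element of A B is written in only one way as a product of an element
    of A and an element of B. *)
Definition unique_products (M : monoidType) : Prop :=
  forall A B : {fset M}, A != fset0 -> B != fset0 ->
  exists a b, [/\ a \in A, b \in B &
    forall a' b', a' \in A -> b' \in B -> (a' * b' = a * b)%g ->
      a' = a /\ b' = b].

Lemma ma_mul_eq0 (R : idomainType) (M : monoidType)
    (f g : monoid_algebra R M) :
  unique_products M -> f * g = 0 -> f = 0 \/ g = 0.
Proof.
move=> uniqM fg0.
have supp0 (h : {malg R[M]}) : msupp h = fset0 -> h = 0.
  by move=> h0; rewrite [h]monalgE h0 big_seq_fset0.
have [f0|fN0] := eqVneq (msupp f) fset0; first by left; apply: supp0.
have [g0|gN0] := eqVneq (msupp g) fset0; first by right; apply: supp0.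
have [a [b [af bg ab_uniq]]] := uniqM _ _ fN0 gN0.
(* No other pair of support elements contributes to the coefficient at a b. *)
have : mcoeff (a * b)%g (ma_mul f g) = mcoeff a f * mcoeff b g.
  rewrite /ma_mul raddf_sum (big_fsetD1 a af) /= raddf_sum (big_fsetD1 b bg) /=.
  rewrite mcoeffUU !big_seq !big1 ?addr0 // => [a'|b'].
    rewrite in_fsetD1 => /andP[a'Na a'f].
    rewrite raddf_sum big_seq big1 // => b' b'g.
    rewrite /= mcoeffU; case: eqP => // /ab_uniq[] // a'a.
    by rewrite a'a eqxx in a'Na.
  rewrite in_fsetD1 => /andP[b'Nb b'g].
  rewrite /= mcoeffU; case: eqP => // /ab_uniq[] // _ b'b.
  by rewrite b'b eqxx in b'Nb.
rewrite -[ma_mul f g]/(f * g) fg0 mcoeff0 => /esym/eqP.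
by rewrite mulf_eq0 !mcoeff_eq0 af bg.
Qed.

(** The exponents (m, n) of x^m y^n, in the lexicographically ordered type. *)
Definition Sxy_lexi (s : Sxy) : nat *l int := (xexp s, yexp s).

Lemma Sxy_lexi_inj : injective Sxy_lexi.
Proof. by case=> [m n] [p q] [-> ->]. Qed.

Lemma fset_lexi_max (A : {fset Sxy}) : A != fset0 ->
  exists2 a, a \in A & forall a', a' \in A -> (Sxy_lexi a' <= Sxy_lexi a)%O.
Proof.
case/fset0Pn=> a0 Aa0.
have [i _ imax] := @Order.TotalTheory.arg_maxP _ _ _ [` Aa0]%fset predT
  (fun i : A => Sxy_lexi (val i)) isT.
exists (val i) => [|a' Aa']; first exact: valP.
exact: (imax [` Aa']%fset).
Qed.

Lemma Sxy_lexi_ltM2r (c a b : Sxy) :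
  (Sxy_lexi a < Sxy_lexi b)%O -> (Sxy_lexi (a * c)%g < Sxy_lexi (b * c)%g)%O.
Proof.
case: a b c => [m n] [p q] [r s].
rewrite !ltEprodlexi /= !leEnat !leq_add2r => /andP[-> /implyP lt_nq] /=.
by apply/implyP=> /lt_nq; rewrite ltrD2r ltr_pM2r // exprn_gt0.
Qed.

Lemma Sxy_lexi_leM2l (c a b : Sxy) :
  (Sxy_lexi a <= Sxy_lexi b)%O -> (Sxy_lexi (c * a)%g <= Sxy_lexi (c * b)%g)%O.
Proof.
case: a b c => [m n] [p q] [r s].
rewrite !leEprodlexi /= !leEnat !leq_add2l => /andP[le_mp /implyP le_nq].
rewrite le_mp /=; apply/implyP=> le_pm.
have <- : m = p by apply/eqP; rewrite eqn_leq le_mp.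
by rewrite lerD2l le_nq.
Qed.

Lemma Sxy_mulgI (c a b : Sxy) : (c * a = c * b)%g -> a = b.
Proof.
case: a b c => [m n] [p q] [r s] [] /addnI <-.
by move=> /addrI <-.
Qed.

Lemma Sxy_unique_products : unique_products Sxy.
Proof.
move=> A B /fset_lexi_max[a Aa a_max] /fset_lexi_max[b Bb b_max].
exists a, b; split=> // a' b' Aa' Bb' eq_ab.
(* If a' < a, then a' b' < a b' <= a b, against a' b' = a b. *)
have a'a : a' = a.
  apply/Sxy_lexi_inj/eqP; rewrite eq_le a_max //= leNgt; apply/negP=> lt_a'a.
  have := lt_le_trans (Sxy_lexi_ltM2r b' lt_a'a)
                      (Sxy_lexi_leM2l a (b_max _ Bb')).
  by rewrite eq_ab ltxx.
by split=> //; apply: (@Sxy_mulgI a); rewrite -[in LHS]a'a.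
Qed.

Lemma CS_mul1C (R : realType) (a b : CS R) : b * a = 1 -> a * b = 1.
Proof.
move=> ba1.
have : b * (a * b - 1) = 0 by rewrite mulrBr mulrA ba1 mul1r mulr1 subrr.
case/(ma_mul_eq0 Sxy_unique_products) => [b0|/eqP]; last first.
  by rewrite subr_eq0 => /eqP.
by move/eqP: ba1; rewrite b0 mul0r eq_sym oner_eq0.
Qed.

Theorem mainTheorem11 (R : realType) (a b : CS R) :
  b * a = 1 <-> a * b = 1.
Proof. by split; exact: CS_mul1C. Qed.
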